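(* Let $K$ be a finite regular cellular complex such that $|K|$ is a manifold without boundary, let $V$ be the discrete gradient vector field of a discrete Morse function on $K$, and let $s$ be a critical cell. Then the construction of the descending region $D(s)$ (frame construction followed by the recursive completion step, as described in the context) ends in a finite number of steps.
   Context: Discrete Morse function. A discrete Morse function on a regular cellular complex $K$ is a map $f$ assigning a real number to each cell such that for every cell $\tau^{(p)}$ (superscripts denote dimension) $b(\tau)=\#\{\nu^{(p-1)}<\tau : f(\nu)\ge f(\tau)\}\le 1$ and $a(\tau)=\#\{\sigma^{(p+1)}>\tau : f(\tau)\ge f(\sigma)\}\le 1$, where $<$ is the face relation. The numbers $a(\tau),b(\tau)$ are never both $1$. A cell is critical if $a(\tau)=b(\tau)=0$ and regular otherwise; $A$ is the set of cells with $a=1$ and $B$ the set of cells with $b=1$. The discrete gradient vector field is the bijection $V:A\to B$ sending $\tau^{(p)}\in A$ to the unique $\sigma^{(p+1)}>\tau$ with $f(\tau)\ge f(\sigma)$. Pairs $(\tau,V(\tau))$ are called $V$-pairs; critical cells are exactly the unpaired cells. Construction of descending regions. Critical cells are processed in order of ascending dimension, so when a critical cell of dimension $p$ is processed, the descending regions of all critical cells of smaller dimension are already constructed. Let $s$ be a critical cell of dimension $p$. Step 1 (frame). The frame $\mathtt{fr}(s)$ is built by breadth-first search: start with $\mathtt{fr}(s)=\{s\}$; whenever a $p$-cell $\sigma$ is in the frame and $\tau$ is a $(p-1)$-dimensional face of $\sigma$ with $\tau\in A$, add $\tau$ and the $p$-cell $V(\tau)$ to the frame; stop when nothing new can be added.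 All cells of $\mathtt{fr}(s)$ are put into $D(s)$. Step 2 (completion). Run through all $V$-pairs $(\alpha^{(d)},\beta^{(d+1)})$, not in the frame, that are incident to the frame (i.e. $\alpha$ is a face of a $p$-cell of $\mathtt{fr}(s)$), and apply to each pair not yet processed the following recursive routine. Let $S$ be the set of $(d+1)$-dimensional cofaces of $\alpha$ that are different from $\beta$ and are incident to (faces of) some $p$-cell of $\mathtt{fr}(s)$. Check whether all elements of $S$ belong to $D(s)$: when an element $\gamma\in S$ is encountered whose $V$-pair has not been processed, that pair is processed first by the same routine. If some $\gamma\in S$ is found that belongs to the descending region of another critical cell of dimension less than $p$ (or that has not been included in $D(s)$ after its own pair has been processed), the routine ends and neither $\alpha$ nor $\beta$ is included in $D(s)$. If all elements of $S$ have been included in $D(s)$, then both $\alpha$ and $\beta$ are included in $D(s)$. The descending region $D(s)$ is the set of all cells included in Steps 1 and 2. *)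

(* Defs.v *)
(* MathComp and MathComp-Analysis. *)
From HB Require Import structures.
From mathcomp Require Import all_boot all_order all_algebra.
From mathcomp Require Import all_classical all_reals all_analysis.
From Stdlib Require Export Relation_Operators.

Set Implicit Arguments.
Unset Strict Implicit.
Unset Printing Implicit Defensive.

Import Order.TTheory GRing.Theory Num.Theory.
Import numFieldNormedType.Exports.

Local Open Scope classical_set_scope.
Local Open Scope ring_scope.

(* [f] is a homeomorphism from the subspace [A] onto the subspace [B], with
   inverse [g]; nothing is required of [f] and [g] outside [A] and [B]. *)
Definition homeo_between (X Y : topologicalType) (A : set X) (B : set Y)
    (f : X -> Y) (g : Y -> X) : Prop :=
  [/\ {within A, continuous f}, {within B, continuous g},
      forall x, A x -> B (f x) /\ g (f x) = x &
      forall y, B y -> A (g y) /\ f (g y) = y].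

Definition closed_disc (R : realType) (n : nat) : set 'rV[R]_n :=
  [set v | \sum_(i < n) v ord0 i ^+ 2 <= 1].

Definition open_disc (R : realType) (n : nat) : set 'rV[R]_n :=
  [set v | \sum_(i < n) v ord0 i ^+ 2 < 1].

Arguments closed_disc : clear implicits.
Arguments open_disc : clear implicits.

Definition manifold_without_boundary (R : realType) (X : topologicalType)
    : Prop :=
  [/\ hausdorff_space X, @second_countable X &
      exists n : nat, forall x : X, exists U : set X, exists W : set 'rV[R]_n,
        [/\ open U, U x, open W & exists f g, homeo_between U W f g]].

(* A finite regular CW structure on [X], so that |K| is [X].  The cells are
   indexed by a finite type; as there are finitely many of them and [X] is
   Hausdorff, closure-finiteness and the weak topology are automatic. *)
Record regular_complex (R : realType) (X : topologicalType) := RegularComplex {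
  cell :> finType;
  dim : cell -> nat;
  open_cell : cell -> set X;
  complex_hausdorff : hausdorff_space X;
  open_cell_partition : forall x : X, exists! c : cell, open_cell c x;
  characteristic_map : forall c : cell,
    exists (phi : 'rV[R]_(dim c) -> X) (psi : X -> 'rV[R]_(dim c)),
      homeo_between (closed_disc R (dim c)) (closure (open_cell c)) phi psi /\
      phi @` open_disc R (dim c) = open_cell c;
  cell_frontier : forall (c : cell) (x : X),
    closure (open_cell c) x -> ~ open_cell c x ->
    exists c' : cell, (dim c' < dim c)%N /\ open_cell c' x }.

Arguments dim {R X} K c : rename.
Arguments open_cell {R X} K c _ : rename.

(* [proper_face t s] is t < s. *)
Definition proper_face (R : realType) (X : topologicalType)
    (K : regular_complex R X) (t s : K) : bool :=
  (t != s) && `[< open_cell K t `<=` closure (open_cell K s) >].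

Definition facet (R : realType) (X : topologicalType)
    (K : regular_complex R X) (t s : K) : bool :=
  (dim K s == (dim K t).+1) && proper_face t s.

Definition morse_a (R : realType) (X : topologicalType)
    (K : regular_complex R X) (f : K -> R) (t : K) : nat :=
  #|[pred s : K | facet t s && (f s <= f t)]|.

Definition morse_b (R : realType) (X : topologicalType)
    (K : regular_complex R X) (f : K -> R) (t : K) : nat :=
  #|[pred v : K | facet v t && (f t <= f v)]|.

Definition discrete_morse (R : realType) (X : topologicalType)
    (K : regular_complex R X) (f : K -> R) : Prop :=
  forall t : K, (morse_a f t <= 1)%N /\ (morse_b f t <= 1)%N.

Definition critical (R : realType) (X : topologicalType)
    (K : regular_complex R X) (f : K -> R) (t : K) : bool :=
  (morse_a f t == 0%N) && (morse_b f t == 0%N).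

Definition cells_A (R : realType) (X : topologicalType)
    (K : regular_complex R X) (f : K -> R) : {set K} :=
  [set t : K | morse_a f t == 1%N].

(* The map V as a partial map: for a discrete Morse function it is defined
   exactly on [cells_A f], and the picked cell is then unique. *)
Definition gradient (R : realType) (X : topologicalType)
    (K : regular_complex R X) (f : K -> R) (t : K) : option K :=
  [pick s : K | facet t s && (f s <= f t)].

Definition Vpair (R : realType) (X : topologicalType)
    (K : regular_complex R X) (f : K -> R) (x y : K) : bool :=
  gradient f x == Some y.

Definition exits (R : realType) (X : topologicalType)
    (K : regular_complex R X) (f : K -> R) (c : K) : {set K} :=
  [set t in cells_A f | facet t c].

Definition exit_targets (R : realType) (X : topologicalType)
    (K : regular_complex R X) (f : K -> R) (c : K) : {set K} :=
  [set y | [exists t in exits f c, Vpair f t y]].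

Definition incident (R : realType) (X : topologicalType)
    (K : regular_complex R X) (s : K) (F : {set K}) (c : K) : bool :=
  [exists u in F, (dim K u == dim K s) && proper_face c u].

(* The set S of the completion routine for the pair (x, y). *)
Definition side_cofaces (R : realType) (X : topologicalType)
    (K : regular_complex R X) (s : K) (F : {set K}) (x y : K) : {set K} :=
  [set c | [&& facet x c, c != y & incident s F c]].

Definition in_lower_region (R : realType) (X : topologicalType)
    (K : regular_complex R X) (f : K -> R) (D : K -> {set K}) (s c : K) : bool :=
  [exists t : K, [&& critical f t, (dim K t < dim K s)%N & c \in D t]].

(* The completion routine still has to be run on the V-pair (x, y).  A V-pair
   is recorded in [P] by its smaller cell. *)
Definition unprocessed (R : realType) (X : topologicalType)
    (K : regular_complex R X) (f : K -> R) (F P : {set K}) (x y : K) : bool :=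
  [&& Vpair f x y, ~~ ((x \in F) && (y \in F)) & x \notin P].

(* Snapshots of the construction of D(s).
   - [Framing F Q]: breadth-first search with frame [F] and queue [Q].
   - [Completing F E P stack]: the frame is [F], the cells included in D(s) so
     far are [E], the pairs whose routine has returned are [P].  An entry
     [(x, T)] of [stack] is a pending call of the routine on the pair (x, V(x)),
     [T] being the elements of its set S that are still to be checked.  A pair
     enters [P] only when its call returns, so cyclic calls would make the
     stack grow for ever.
   - [Done E]: the construction has stopped with D(s) = [E]. *)
Inductive snapshot (R : realType) (X : topologicalType)
    (K : regular_complex R X) : Type :=
| Framing of {set K} & seq K
| Completing of {set K} & {set K} & {set K} & seq (K * seq K)
| Done of {set K}.

Arguments Framing {R X K} _ _.
Arguments Completing {R X K} _ _ _ _.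
Arguments Done {R X K} _.

Definition start (R : realType) (X : topologicalType)
    (K : regular_complex R X) (s : K) : snapshot K :=
  Framing [set s]%SET [:: s].

(* One step of the construction of D(s), where [D] gives the descending regions
   of the critical cells of smaller dimension.  The orders in which new cells
   are queued, pairs are run through and S is listed are left arbitrary. *)
Inductive step (R : realType) (X : topologicalType) (K : regular_complex R X)
    (f : K -> R) (D : K -> {set K}) (s : K) : snapshot K -> snapshot K -> Prop :=
| step_frame (F : {set K}) (c : K) (Q new : seq K) :
    perm_eq new (enum (exit_targets f c :\: F)) ->
    step f D s (Framing F (c :: Q))
      (Framing (F :|: exits f c :|: exit_targets f c) (Q ++ new))
| step_frame_end (F : {set K}) :
    step f D s (Framing F [::]) (Completing F F finset.set0 [::])
| step_select (F E P : {set K}) (x y : K) (T : seq K) :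
    unprocessed f F P x y -> incident s F x ->
    perm_eq T (enum (side_cofaces s F x y)) ->
    step f D s (Completing F E P [::]) (Completing F E P [:: (x, T)])
| step_call (F E P : {set K}) (x : K) (c : K) (T : seq K)
    (rest : seq (K * seq K)) (x' y' : K) (T' : seq K) :
    unprocessed f F P x' y' -> (c == x') || (c == y') ->
    perm_eq T' (enum (side_cofaces s F x' y')) ->
    step f D s (Completing F E P ((x, c :: T) :: rest))
      (Completing F E P ((x', T') :: (x, c :: T) :: rest))
| step_reject (F E P : {set K}) (x : K) (c : K) (T : seq K)
    (rest : seq (K * seq K)) :
    (forall x' y', (c == x') || (c == y') -> ~~ unprocessed f F P x' y') ->
    in_lower_region f D s c || (c \notin E) ->
    step f D s (Completing F E P ((x, c :: T) :: rest))
      (Completing F E (x |: P) rest)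
| step_check (F E P : {set K}) (x : K) (c : K) (T : seq K)
    (rest : seq (K * seq K)) :
    (forall x' y', (c == x') || (c == y') -> ~~ unprocessed f F P x' y') ->
    ~~ in_lower_region f D s c -> c \in E ->
    step f D s (Completing F E P ((x, c :: T) :: rest))
      (Completing F E P ((x, T) :: rest))
| step_accept (F E P : {set K}) (x y : K) (rest : seq (K * seq K)) :
    Vpair f x y ->
    step f D s (Completing F E P ((x, [::]) :: rest))
      (Completing F (x |: (y |: E)) (x |: P) rest)
| step_stop (F E P : {set K}) :
    (forall x y, unprocessed f F P x y -> ~~ incident s F x) ->
    step f D s (Completing F E P [::]) (Done E).

Definition finished (R : realType) (X : topologicalType)
    (K : regular_complex R X) (c : snapshot K) : Prop :=
  exists E : {set K}, c = Done E.

(* [D t] is a result of the construction for each critical [t] of smaller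
   dimension than [s]. *)
Definition lower_regions_constructed (R : realType) (X : topologicalType)
    (K : regular_complex R X) (f : K -> R) (s : K) (D : K -> {set K}) : Prop :=
  forall t : K, critical f t -> (dim K t < dim K s)%N ->
    clos_refl_trans (snapshot K) (step f D t) (start t) (Done (D t)).

(* Every execution from [c], whatever choices it makes, reaches [final] after
   finitely many steps: it neither runs for ever nor gets stuck before. *)
Inductive always_ends (T : Type) (next : T -> T -> Prop) (final : T -> Prop)
    (c : T) : Prop :=
| ends_now of final c
| ends_later of (exists c', next c c') &
    (forall c', next c c' -> always_ends next final c').

(* Main.v *)
Require Import Defs.
From mathcomp Require Import all_boot all_order all_algebra.
From mathcomp Require Import all_classical all_reals all_analysis.

Set Implicit Arguments.
Unset Strict Implicit.
Unset Printing Implicit Defensive.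

Import Order.TTheory.

(** The frame search ends because every queued cell is new to the frame, and
    the frame lies in the finite set of cells.

    The completion step could only run for ever through an endless chain of
    nested calls of the routine.  The Morse function [f] forbids this: its value
    on the smaller cell of the pair strictly increases from each call to the
    call nested in it.  Indeed, let the routine on the pair (x, y) meet the
    coface [c] of [x], with [c] different from [y].  As [y] is already a coface
    of [x] with [f y <= f x] and there is at most one such coface,
    [f x < f c] ([lt_side_coface]).  If [c] is the smaller cell of its own pair
    (x', y'), then [f x < f x']; if it is the larger one, then
    [f x < f c <= f x'] as well ([lt_nested_call]).

    Hence the pending calls are pairwise distinct, and none of them has returned
    yet.  This bounds the stack by the number of cells not recorded as returned,
    so that a natural number attached to each snapshot ([cost]) drops at every
    step ([step_decr]).  Moreover an unfinished snapshot always admits a step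
    ([step_progress]); together these give [construction_ends].

    The lower regions themselves come by induction on the dimension: a step for
    a cell only consults the regions of critical cells of smaller dimension
    ([step_lower_ext]), so regions already built can be kept while a terminating
    execution supplies those of the next dimension ([regions_below]). *)

(** * Executions governed by a decreasing measure *)

Lemma always_ends_measure {T : Type} {next : T -> T -> Prop}
    {final : T -> Prop} (inv : T -> Prop) (mu : T -> nat) :
  (forall c, inv c -> final c \/ exists c', next c c') ->
  (forall c c', inv c -> next c c' -> inv c' /\ mu c' < mu c) ->
  forall c, inv c -> always_ends next final c.
Proof.
move=> progress decr c; have [n] := ubnP (mu c).
elim: n c => // n IHn c ltcn invc.
have [finc|nextc] := progress c invc; first exact: ends_now.
apply: ends_later => // c' /(decr _ _ invc) [invc' ltc'].
by apply: IHn => //; apply: leq_trans ltc' _.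
Qed.

Lemma always_ends_reaches {T : Type} {next : T -> T -> Prop}
    {final : T -> Prop} c :
  always_ends next final c ->
  exists2 c', clos_refl_trans T next c c' & final c'.
Proof.
elim=> {c} [c finc|c [c' cc'] _ IH]; first by exists c => //; apply: rt_refl.
have [d c'd find] := IH c' cc'.
by exists d => //; apply: rt_trans c'd; apply: rt_step.
Qed.

(** * Nested calls climb the Morse function *)

Section Gradient.

Context {R : realType} {X : topologicalType} {K : regular_complex R X}.
Context {f : K -> R}.

Lemma Vpair_facet {x y : K} : Vpair f x y -> facet x y && (f y <= f x)%R.
Proof. by rewrite /Vpair /gradient; case: pickP => // z zP /eqP[<-]. Qed.

(** Otherwise [y] and [c] would be two distinct cofaces of [x] counted by
    [morse_a f x]. *)
Lemma lt_side_coface (hf : discrete_morse f) s F {x y c : K} :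
  Vpair f x y -> c \in side_cofaces s F x y -> (f x < f c)%R.
Proof.
move=> /Vpair_facet xy; rewrite inE => /and3P[xc /negP cy _].
rewrite ltNge; apply/negP => lecx; apply: cy; apply/eqP.
have /card_le1_eqP le1 := (hf x).1.
by apply: le1; rewrite inE // xc.
Qed.

(** A nested call is made on the pair (x', y') to which [c] belongs; the side of
    the pair on which [c] lies decides its dimension, but in both cases
    [f c <= f x']. *)
Lemma lt_nested_call (hf : discrete_morse f) s F {x y c x' y' : K} :
  Vpair f x y -> c \in side_cofaces s F x y ->
  Vpair f x' y' -> (c == x') || (c == y') -> (f x < f x')%R.
Proof.
move=> xy /(lt_side_coface hf xy) ltxc /Vpair_facet /andP[_ ley'x'].
by case/orP=> /eqP ec; rewrite -ec // in ley'x' *; apply: lt_le_trans ltxc _.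
Qed.

End Gradient.

(** * Termination *)

Section Termination.

Context {R : realType} {X : topologicalType} {K : regular_complex R X}.
Context {f : K -> R} (hf : discrete_morse f) (D : K -> {set K}) (s : K).

(** The innermost call is at the head of the stack, so values of [f] decrease
    from left to right; each entry remembers that its unchecked cells come from
    the set S of its pair, which is what [lt_nested_call] asks for. *)
Record stack_inv (F P : {set K}) (st : seq (K * seq K)) : Prop := StackInv {
  stack_decr : sorted (fun x x' => f x' < f x)%R [seq e.1 | e <- st];
  stack_pending : {in st, forall e, e.1 \notin P};
  stack_pairs : forall e, e \in st ->
    exists2 y, Vpair f e.1 y & {subset e.2 <= side_cofaces s F e.1 y} }.

Definition snapshot_inv (c : snapshot K) : Prop :=
  if c is Completing F E P st then stack_inv F P st else True.

(** Each cell that can still enter the stack is charged [#|K|.+2].  Once it is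
    pending, with the cells [T] left to check, it costs only [(size T).+1], so
    that a call lowers the cost.  When a call returns its cell leaves both the
    stack and the complement of [P], so the first term is unchanged and the
    second one drops.  The frame search is charged in advance for the whole
    completion step. *)
Definition cost (c : snapshot K) : nat :=
  match c with
  | Framing F Q => (#|~: F| + size Q + #|K|.+2 * #|K|).+2
  | Completing F E P st =>
      (#|K|.+2 * (#|~: P| - size st) + \sum_(e <- st) (size e.2).+1).+1
  | Done _ => 0
  end.

Lemma stack_uniq F P st : stack_inv F P st -> uniq [seq e.1 | e <- st].
Proof.
case=> srt _ _; apply: sorted_uniq srt => [x y z ltxy ltyz|x].
  exact: lt_trans ltyz ltxy.
exact: ltxx.
Qed.

(** Without this bound the truncated subtraction in [cost] could vanish, and a
    call would raise the cost. *)
Lemma stack_size F P st : stack_inv F P st -> size st <= #|~: P|.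
Proof.
move=> inv; rewrite -(size_map (fun e => e.1)) cardE.
apply: uniq_leq_size; first exact: stack_uniq inv.
move=> _ /mapP[e est ->]; rewrite mem_enum inE.
exact: (stack_pending inv est).
Qed.

Lemma stack_pop F P e st : stack_inv F P (e :: st) -> stack_inv F (e.1 |: P) st.
Proof.
move=> inv; have /= /andP[ne _] := stack_uniq inv.
case: inv => srt pend prs; split.
- exact: path_sorted srt.
- move=> e' e'st; rewrite in_setU1 negb_or pend ?inE ?e'st ?orbT // andbT.
  by apply: contraNneq ne => <-; apply: map_f.
- by move=> e' e'st; apply: prs; rewrite inE e'st orbT.
Qed.

Lemma stack_push F P x y T st :
  unprocessed f F P x y -> perm_eq T (enum (side_cofaces s F x y)) ->
  path (fun x x' => f x' < f x)%R x [seq e.1 | e <- st] ->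
  stack_inv F P st -> stack_inv F P ((x, T) :: st).
Proof.
move=> /and3P[xy _ xP] eqT pth [_ pend prs]; split=> //= e.
- by rewrite inE => /predU1P[-> //|]; apply: pend.
- rewrite inE => /predU1P[->|]; last exact: prs.
  by exists y => // c /=; rewrite (perm_mem eqT) mem_enum.
Qed.

Lemma stack_check F P x c T st :
  stack_inv F P ((x, c :: T) :: st) -> stack_inv F P ((x, T) :: st).
Proof.
case=> srt pend prs; split=> // e; rewrite inE => /predU1P[->|est] /=.
- exact: (pend (x, c :: T) (mem_head _ _)).
- by apply: pend; rewrite inE est orbT.
- have [y xy sub] := prs (x, c :: T) (mem_head _ _).
  by exists y => // z zT; apply: sub; rewrite inE zT orbT.
- by apply: prs; rewrite inE est orbT.
Qed.

Lemma cost_pop F E E' P e st : stack_inv F P (e :: st) ->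
  cost (Completing F E' (e.1 |: P) st) < cost (Completing F E P (e :: st)).
Proof.
move=> inv; have eP := stack_pending inv (mem_head _ _).
rewrite /= !ltnS big_cons.
have -> : #|~: P| = #|~: (e.1 |: P)|.+1.
  rewrite (cardsD1 e.1 (~: P)) inE eP.
  by rewrite add1n; congr _.+1; apply: eq_card => z; rewrite !inE negb_or.
by rewrite subSS ltn_add2l addSn ltnS leq_addl.
Qed.

Lemma cost_push F E P x T st : size T <= #|K| ->
  stack_inv F P ((x, T) :: st) ->
  cost (Completing F E P ((x, T) :: st)) < cost (Completing F E P st).
Proof.
move=> leT /stack_size /= ltst; rewrite !ltnS big_cons /=.
have -> : #|~: P| - size st = (#|~: P| - (size st).+1).+1.
  by rewrite -subSn.
by rewrite mulnSr -addnA ltn_add2l ltn_add2r !ltnS.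
Qed.

Lemma cost_check F E P x c T st :
  cost (Completing F E P ((x, T) :: st))
    < cost (Completing F E P ((x, c :: T) :: st)).
Proof. by rewrite /= !big_cons /= !ltnS ltn_add2l ltn_add2r. Qed.

Lemma cost_frame F (c : K) Q new :
  perm_eq new (enum (exit_targets f c :\: F)) ->
  cost (Framing (F :|: exits f c :|: exit_targets f c) (Q ++ new))
    < cost (Framing F (c :: Q)).
Proof.
set F' := _ :|: exit_targets f c; move=> /perm_size eqnew.
(* New cells are taken from outside [F] into [F'], so each enlargement of the
   queue is paid for by the complement of the frame. *)
have lenew : #|~: F'| + size new <= #|~: F|.
  rewrite eqnew -cardE -(cardsID (exit_targets f c) (~: F)) addnC.
  apply: leq_add; apply: subset_leq_card; apply/fintype.subsetP => z.
    by rewrite !inE => /andP[zF zt]; rewrite zF zt.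
  by rewrite !inE !negb_or => /andP[/andP[-> _] ->].
by rewrite /= !ltnS ltn_add2r addnS ltnS size_cat addnCA addnC leq_add2r.
Qed.

Lemma step_decr c c' : snapshot_inv c -> step f D s c c' ->
  snapshot_inv c' /\ cost c' < cost c.
Proof.
have leT F x y T : perm_eq T (enum (side_cofaces s F x y)) -> size T <= #|K|.
  by move=> /perm_size ->; rewrite -cardE max_card.
move=> inv st; case: st inv => {c c'} //.
- by move=> F c Q new eqnew _; split=> //; apply: cost_frame.
- move=> F _; split=> //; rewrite /= big_nil addn0 subn0 finset.setC0 cardsT.
  by rewrite !ltnS leq_addl.
- move=> F E P x y T unp _ eqT inv.
  have inv' : stack_inv F P [:: (x, T)] by apply: stack_push unp eqT _ inv.
  by split=> //; apply: cost_push inv'; apply: leT eqT.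
- move=> F E P x c T rest x' y' T' unp cx' eqT inv.
  have inv' : stack_inv F P ((x', T') :: (x, c :: T) :: rest).
    apply: (stack_push unp eqT _ inv) => /=.
    have /= -> := stack_decr inv; rewrite andbT.
    have [y xy sub] := stack_pairs inv (mem_head _ _).
    have /and3P[xy' _ _] := unp.
    exact: (lt_nested_call hf xy (sub c (mem_head _ _)) xy' cx').
  by split=> //; apply: cost_push inv'; apply: leT eqT.
- move=> F E P x c T rest _ _ inv.
  by split; [exact: stack_pop inv | exact: cost_pop inv].
- move=> F E P x c T rest _ _ _ inv.
  by split; [exact: stack_check inv | exact: cost_check].
- move=> F E P x y rest _ inv.
  by split; [exact: stack_pop inv | exact: cost_pop inv].
Qed.

Lemma step_progress c : snapshot_inv c ->
  finished c \/ exists c', step f D s c c'.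
Proof.
case: c => [F [|c Q]|F E P [|[x [|c T]] rest]|E] inv; last by left; exists E.
all: right.
- by eexists; apply: step_frame_end.
- by eexists; apply: step_frame; apply: perm_refl.
- have [[x [y [unp inc]]]|none] :=
    pselect (exists x y, unprocessed f F P x y /\ incident s F x).
    by eexists; apply: step_select unp inc (perm_refl _).
  eexists; apply: step_stop => x y unp; apply/negP => inc.
  by apply: none; exists x, y.
- have [y xy _] := stack_pairs inv (mem_head _ _).
  by eexists; apply: step_accept xy.
- have [[x' [y' [cx' unp]]]|none] :=
    pselect (exists x' y', (c == x') || (c == y') /\ unprocessed f F P x' y').
    by eexists; apply: step_call unp cx' (perm_refl _).
  have processed x' y' : (c == x') || (c == y') -> ~~ unprocessed f F P x' y'.
    by move=> cx'; apply/negP => unp; apply: none; exists x', y'.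
  have [rej|/norP[low /negPn cE]] :=
      boolP (in_lower_region f D s c || (c \notin E)).
    by eexists; apply: step_reject rej.
  by eexists; apply: step_check cE.
Qed.

Lemma construction_ends :
  always_ends (step f D s) (@finished R X K) (start s).
Proof.
exact: (always_ends_measure (inv := snapshot_inv) step_progress step_decr).
Qed.

End Termination.

(** * Regions of the critical cells of smaller dimension *)

Section LowerRegions.

Context {R : realType} {X : topologicalType} {K : regular_complex R X}.
Context {f : K -> R}.

Lemma step_lower_ext (D D' : K -> {set K}) s c c' :
  (forall t, Defs.dim K t < Defs.dim K s -> D t = D' t) ->
  step f D s c c' -> step f D' s c c'.
Proof.
move=> eqD.
have eq_low z : in_lower_region f D s z = in_lower_region f D' s z.
  by apply: eq_existsb => t; case: ltnP => [/eqD ->|]; rewrite ?andbF.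
case=> {c c'} *; try by econstructor; eauto.
- by apply: step_reject; rewrite -?eq_low.
- by apply: step_check; rewrite -?eq_low.
Qed.

Lemma steps_lower_ext (D D' : K -> {set K}) s c c' :
  (forall t, Defs.dim K t < Defs.dim K s -> D t = D' t) ->
  clos_refl_trans _ (step f D s) c c' -> clos_refl_trans _ (step f D' s) c c'.
Proof.
move=> eqD; elim=> {c c'} [c c' cc'|c|c d c' _ cd _ dc'].
- exact/rt_step/(step_lower_ext eqD).
- exact: rt_refl.
- exact: rt_trans cd dc'.
Qed.

(** The regions of all dimensions below [n] are built at once because the regions
    in dimension [n] are computed from one common family of lower regions. *)
Lemma regions_below (hf : discrete_morse f) n : exists D : K -> {set K},
  forall t, critical f t -> Defs.dim K t < n ->
    clos_refl_trans _ (step f D t) (start t) (Done (D t)).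
Proof.
elim: n => [|n [D DP]]; first by exists (fun=> finset.set0).
have /choice[E EP] : forall t, exists Et : {set K},
    clos_refl_trans _ (step f D t) (start t) (Done Et).
  move=> t; have [c tc [Et cE]] := always_ends_reaches (construction_ends hf D t).
  by exists Et; rewrite -cE.
pose D' t := if Defs.dim K t < n then D t else E t.
exists D' => t crt; rewrite ltnS => let_n.
apply: (steps_lower_ext (D := D)) => [u ltut|].
  by rewrite /D' (leq_trans ltut let_n).
by rewrite /D'; case: ltnP => [ltt|_]; [exact: DP | exact: EP].
Qed.

End LowerRegions.

Theorem proposition1 (R : realType) (X : topologicalType)
    (K : regular_complex R X) (hX : manifold_without_boundary R X)
    (f : K -> R) (hf : discrete_morse f) (s : K) (hs : critical f s) :
  (exists D : K -> {set K}, lower_regions_constructed f s D) /\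
  (forall D : K -> {set K}, lower_regions_constructed f s D ->
     always_ends (step f D s) (@finished R X K) (start s)).
Proof.
split; first exact: regions_below.
by move=> D _; apply: construction_ends.
Qed.
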